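(* Let $(X,\delta_X)$ and $(Y,\delta_Y)$ be semimetric-like ordinal spaces. Then $(X,\delta_X)$ and $(Y,\delta_Y)$ are isomorphic if and only if any realizations $(X,d_X)$ of $(X,\delta_X)$ and $(Y,d_Y)$ of $(Y,\delta_Y)$ are weakly similar (i.e. for every choice of realizations $(X,d_X)$ and $(Y,d_Y)$, the two semimetric spaces are weakly similar).
   Context: An ordinal space is an ordered triplet $(X,L,\delta)$, also written $(X,\delta)$, where $X$ is a set, $L$ is a linearly ordered set with minimal element $0$, and $\delta\colon X\times X\to L$ is a surjective mapping such that for all $x,y\in X$: (i) $\delta(x,y)=\delta(y,x)$; (ii) $\delta(x,y)=0$ if and only if $x=y$. Ordinal spaces $(X,\delta_X)$ and $(Y,\delta_Y)$ are isomorphic if there exists a bijection $\Phi\colon X\to Y$ such that for all $x,y,z,w\in X$ the comparison ($<$, $=$ or $>$) of $\delta_X(x,y)$ with $\delta_X(z,w)$ is the same as the comparison of $\delta_Y(\Phi(x),\Phi(y))$ with $\delta_Y(\Phi(z),\Phi(w))$. A semimetric on $X$ is a function $d\colon X\times X\to[0,\infty)$ with $d(x,y)=d(y,x)$ and ($d(x,y)=0\Leftrightarrow x=y$) for all $x,y\in X$; then $(X,d)$ is a semimetric space. A semimetric space $(X,d)$ is a realization of $(X,\delta)$ if for all $x,y,z,w\in X$ the comparison of $\delta(x,y)$ with $\delta(z,w)$ is the same as the comparison of the real numbers $d(x,y)$ and $d(z,w)$. An ordinal space is semimetric-like if it has a realization which is a semimetric space. The spectrum of a semimetric space $(X,d)$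 is $\operatorname{Sp}(X)=\{d(x,y)\colon x,y\in X\}$. Semimetric spaces $(X,d_X)$ and $(Y,d_Y)$ are weakly similar if there exist a bijection $\Phi\colon X\to Y$ and a strictly increasing bijection $f\colon\operatorname{Sp}(X)\to\operatorname{Sp}(Y)$ such that $f(d_X(x,y))=d_Y(\Phi(x),\Phi(y))$ for all $x,y\in X$. *)

(* Defs.v *)
From HB Require Import structures.
From mathcomp Require Import all_boot all_order all_algebra.
From mathcomp Require Import all_classical all_reals.

Set Implicit Arguments.
Unset Strict Implicit.
Unset Printing Implicit Defensive.

Import Order.TTheory GRing.Theory Num.Theory.

Local Open Scope classical_set_scope.
Local Open Scope ring_scope.

(* The minimal element 0 of the linearly ordered set L is Order.bottom; the
   last clause makes delta surjective as a map on X * X, so X is nonempty. *)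
Definition ordinal_space (X : Type) (disp : Order.disp_t)
    (L : bOrderType disp) (delta : X -> X -> L) : Prop :=
  [/\ forall x y, delta x y = delta y x,
      forall x y, delta x y = Order.bottom <-> x = y
    & forall l, exists x y, delta x y = l].

Definition same_comparison (disp1 disp2 : Order.disp_t)
    (T1 : orderType disp1) (T2 : orderType disp2)
    (a b : T1) (a' b' : T2) : Prop :=
  [/\ (a < b)%O <-> (a' < b')%O,
      a = b <-> a' = b'
    & (a > b)%O <-> (a' > b')%O].

Definition ordinal_isomorphic (X Y : Type) (dispX dispY : Order.disp_t)
    (LX : bOrderType dispX) (LY : bOrderType dispY)
    (deltaX : X -> X -> LX) (deltaY : Y -> Y -> LY) : Prop :=
  exists2 Phi : X -> Y, bijective Phi
    & forall x y z w, same_comparison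
        (deltaX x y) (deltaX z w)
        (deltaY (Phi x) (Phi y)) (deltaY (Phi z) (Phi w)).

Definition semimetric (R : realType) (X : Type) (d : X -> X -> R) : Prop :=
  [/\ forall x y, 0 <= d x y,
      forall x y, d x y = d y x
    & forall x y, d x y = 0 <-> x = y].

Definition realization (R : realType) (X : Type) (disp : Order.disp_t)
    (L : bOrderType disp) (delta : X -> X -> L) (d : X -> X -> R) : Prop :=
  semimetric d /\
  forall x y z w,
    same_comparison (delta x y) (delta z w) (d x y) (d z w).

Definition semimetric_like (R : realType) (X : Type) (disp : Order.disp_t)
    (L : bOrderType disp) (delta : X -> X -> L) : Prop :=
  exists d : X -> X -> R, realization delta d.

Definition spectrum (R : realType) (X : Type) (d : X -> X -> R) : set R :=
  [set r | exists x y, d x y = r].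

(* f is a total function on R, but only its restriction to the spectrum of X
   is constrained. *)
Definition weakly_similar (R : realType) (X Y : Type)
    (dX : X -> X -> R) (dY : Y -> Y -> R) : Prop :=
  exists (Phi : X -> Y) (f : R -> R),
    [/\ bijective Phi,
        set_bij (spectrum dX) (spectrum dY) f,
        {in spectrum dX &, {homo f : a b / a < b}}
      & forall x y, f (dX x y) = dY (Phi x) (Phi y)].

(* Main.v *)
Require Import Defs.
From mathcomp Require Import all_boot all_order all_algebra.
From mathcomp Require Import all_classical all_reals.

(** An ordinal space and any of its realizations compare pairs of distances in
    the same way, so an isomorphism of ordinal spaces is the same thing as a
    bijection [Phi] matching the comparisons of any two given realizations
    ([same_comparison_trans] and [same_comparison_sym] let one change
    representatives); realizations exist because both spaces are
    semimetric-like. It remains to see that matching comparisons is what weak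
    similarity means ([weakly_similarP]): the equality comparisons say exactly
    that [dX x y |-> dY (Phi x) (Phi y)] is a well defined injection of spectra,
    the strict ones that it is increasing, and it is onto because [Phi] is. *)

Set Implicit Arguments.
Unset Strict Implicit.
Unset Printing Implicit Defensive.

Import Order.TTheory GRing.Theory Num.Theory.
Local Open Scope classical_set_scope.
Local Open Scope ring_scope.

Lemma same_comparison_sym (disp1 disp2 : Order.disp_t)
    (T1 : orderType disp1) (T2 : orderType disp2) (a b : T1) (a' b' : T2) :
  same_comparison a b a' b' -> same_comparison a' b' a b.
Proof. by case=> lt_ab eq_ab gt_ab; split; apply: iff_sym. Qed.

Lemma same_comparison_trans (disp1 disp2 disp3 : Order.disp_t)
    (T1 : orderType disp1) (T2 : orderType disp2) (T3 : orderType disp3)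
    (a b : T1) (a' b' : T2) (a'' b'' : T3) :
  same_comparison a b a' b' -> same_comparison a' b' a'' b'' ->
  same_comparison a b a'' b''.
Proof.
case=> lt1 eq1 gt1 [lt2 eq2 gt2].
by split; [apply: iff_trans lt1 lt2 | apply: iff_trans eq1 eq2
          | apply: iff_trans gt1 gt2].
Qed.

(** Totality of the order makes a one-directional hypothesis suffice: strict
    monotonicity on a set already reflects [<] and is injective there. *)
Lemma same_comparison_homo (disp1 disp2 : Order.disp_t)
    (T1 : orderType disp1) (T2 : orderType disp2) (A : set T1) (f : T1 -> T2) :
  {in A &, {homo f : a b / (a < b)%O}} ->
  {in A &, forall a b, same_comparison a b (f a) (f b)}.
Proof.
move=> f_incr a b aA bA.
have f_mono : {in A &, {mono f : a b / (a <= b)%O}} := le_mono_in f_incr.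
have f_lt := leW_mono_in f_mono; have f_inj := inc_inj_in f_mono.
by split; rewrite ?f_lt //; split=> [-> // | /f_inj]; apply.
Qed.

(** Trades the scaling function for comparisons, which, unlike the spectra, make
    sense on both sides of a realization. *)
Lemma weakly_similarP (R : realType) (X Y : Type)
    (dX : X -> X -> R) (dY : Y -> Y -> R) :
  weakly_similar dX dY <->
  exists2 Phi : X -> Y, bijective Phi
    & forall x y z w,
        same_comparison (dX x y) (dX z w)
          (dY (Phi x) (Phi y)) (dY (Phi z) (Phi w)).
Proof.
have in_spectrum x y : dX x y \in spectrum dX by rewrite inE; exists x, y.
split=> [[Phi [f [Phi_bij _ f_incr fE]]] | [Phi Phi_bij cmp]].
  exists Phi => // x y z w; rewrite -!fE.
  exact: (@same_comparison_homo _ _ _ _ (spectrum dX)).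
(* The value of [f] at [r] is read off on any pair at distance [r]. *)
have /choice[f f_spec] (r : R) : exists s, forall x y,
    dX x y = r -> s = dY (Phi x) (Phi y).
  have [[x [y <-]] | notr] := pselect (spectrum dX r).
    exists (dY (Phi x) (Phi y)) => z w dzw.
    by have [_ [eq_dY _] _] := cmp x y z w; apply: eq_dY.
  by exists 0 => x y dxy; case: notr; exists x, y.
have fE x y : f (dX x y) = dY (Phi x) (Phi y) by apply: f_spec.
exists Phi, f; split=> //.
- split.
  + by move=> _ [x [y <-]]; rewrite fE; exists (Phi x), (Phi y).
  + move=> a b; rewrite !inE => -[x [y <-]] [z [w <-]]; rewrite !fE.
    by have [_ [_ inj] _] := cmp x y z w.
  + case: Phi_bij => Psi _ PsiK _ [x [y <-]].
    by exists (dX (Psi x) (Psi y)); [exists (Psi x), (Psi y) | rewrite fE !PsiK].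
- move=> a b; rewrite !inE => -[x [y <-]] [z [w <-]]; rewrite !fE.
  by have [[lt_dY _] _ _] := cmp x y z w.
Qed.

Theorem proposition2p5 (R : realType) (X Y : Type)
    (dispX dispY : Order.disp_t)
    (LX : bOrderType dispX) (LY : bOrderType dispY)
    (deltaX : X -> X -> LX) (deltaY : Y -> Y -> LY)
    (hX : ordinal_space deltaX) (hY : ordinal_space deltaY)
    (sX : semimetric_like R deltaX) (sY : semimetric_like R deltaY) :
  ordinal_isomorphic deltaX deltaY <->
  (forall (dX : X -> X -> R) (dY : Y -> Y -> R),
     realization deltaX dX -> realization deltaY dY -> weakly_similar dX dY).
Proof.
split=> [[Phi Phi_bij cmp] dX dY [_ cmpX] [_ cmpY] | sim].
  apply/weakly_similarP; exists Phi => // x y z w.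
  have cmp_dX_deltaX := same_comparison_sym (cmpX x y z w).
  apply: same_comparison_trans (cmpY _ _ _ _).
  exact: same_comparison_trans cmp_dX_deltaX (cmp _ _ _ _).
have [[dX rX] [dY rY]] := (sX, sY).
have /weakly_similarP[Phi Phi_bij cmp] := sim _ _ rX rY.
case: rX rY => _ cmpX [_ cmpY]; exists Phi => // x y z w.
have cmp_dY_deltaY := same_comparison_sym (cmpY (Phi x) (Phi y) (Phi z) (Phi w)).
apply: same_comparison_trans (cmpX _ _ _ _) _.
exact: same_comparison_trans (cmp _ _ _ _) cmp_dY_deltaY.
Qed.
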